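(* Let $G=\langle a,b,r\mid aba^{-1}b^{-1}=r^2=(ra)^2=(rb)^2=1\rangle$ be the wallpaper group ''$p2$'', $\mathbb{C}G$ its group $*$-algebra and $\varepsilon\colon\mathbb{C}G\to\mathbb{C}$ the linear extension of the trivial representation. Then $(\mathbb{C}G,\varepsilon)$ has non-Gaussian cocycles which do not admit a generating functional. Therefore $(\mathbb{C}G,\varepsilon)$ does not have the properties (NC) or (AC), i.e., it has neither of them.
   Context: The group $*$-algebra has involution $g^*=g^{-1}$, and $\varepsilon(g)=1$ for all group elements $g$. Put $A=\mathbb{C}G$. A pre-Hilbert space is a complex vector space $D$ with a positive definite inner product, linear in the second argument; $L(D)$ is the $*$-algebra of adjointable linear operators $D\to D$. For a unital $*$-representation $\pi\colon A\to L(D)$, a $\pi$-$\varepsilon$-cocycle is a linear map $\eta\colon A\to D$ with $\eta(ab)=\pi(a)\eta(b)+\eta(a)\varepsilon(b)$ for all $a,b\in A$. A Schürmann triple is a triple $(\pi,\eta,\psi)$ of such $\pi,\eta$ and a linear functional $\psi\colon A\to\mathbb{C}$ with $\psi(a^* )=\overline{\psi(a)}$ and $\varepsilon(a)\psi(b)-\psi(ab)+\psi(a)\varepsilon(b)=-\langle\eta(a^* ),\eta(b)\rangle$ for all $a,b\in A$. A cocycle $\eta$ (for $\pi$) admits a generating functional if there is $\psi$ such that $(\pi,\eta,\psi)$ is a Schürmann triple. Given $(\pi,\eta)$, replace $D$ by the $\pi$-invariant subspace $\eta(A)$ so that $\eta$ is surjective; let $H$ be the completion of $D$, $P_G$ the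 orthogonal projection of $H$ onto $H_G=\{(\pi(a)-\varepsilon(a))v: a\in A, v\in D\}^\perp$, and $D_G=P_GD$. The cocycle is called (purely) non-Gaussian if $D_G=\{0\}$. (NC): every non-Gaussian cocycle (for any unital $*$-representation on a pre-Hilbert space) admits a generating functional. (AC): every $\pi$-$\varepsilon$-cocycle, for any unital $*$-representation $\pi$ on a pre-Hilbert space, admits a generating functional. *)

(* Defs.v *)
From HB Require Import structures.
From mathcomp Require Import all_boot all_order all_algebra.
From mathcomp Require Import generic_quotient finmap.
From mathcomp Require Import complex boolp classical_sets reals.
From mathcomp.multinomials Require Import monalg.

Set Implicit Arguments.
Unset Strict Implicit.
Unset Printing Implicit Defensive.

Import GRing.Theory Num.Theory.
Local Open Scope quotient_scope.
Local Open Scope ring_scope.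

Section PresentedGroup.
Variables (X : choiceType) (rels : set (seq (X * bool))).

(* A word in the generators: the letter [(x, false)] stands for [x] and
   [(x, true)] for the inverse of [x]. *)
Local Notation word := (seq (X * bool)).

Inductive pres_eq : word -> word -> Prop :=
| pres_refl u : pres_eq u u
| pres_sym u v : pres_eq u v -> pres_eq v u
| pres_trans v u w : pres_eq u v -> pres_eq v w -> pres_eq u w
| pres_cat u u' v v' : pres_eq u u' -> pres_eq v v' ->
    pres_eq (u ++ v) (u' ++ v')
| pres_cancel x e : pres_eq [:: (x, e); (x, ~~ e)] [::]
| pres_rel u : rels u -> pres_eq u [::].

Definition pres_eqb (u v : word) : bool := `[< pres_eq u v >].

Lemma pres_eqb_refl : reflexive pres_eqb.
Proof. by move=> u; apply/asboolP; apply: pres_refl. Qed.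

Lemma pres_eqb_sym : symmetric pres_eqb.
Proof. by move=> u v; apply/asboolP/asboolP; apply: pres_sym. Qed.

Lemma pres_eqb_trans : transitive pres_eqb.
Proof.
by move=> v u w /asboolP uv /asboolP vw; apply/asboolP; apply: pres_trans vw.
Qed.

Canonical pres_equiv :=
  EquivRel pres_eqb pres_eqb_refl pres_eqb_sym pres_eqb_trans.

Definition presented : Type := {eq_quot pres_equiv}.
HB.instance Definition _ := Choice.on presented.

Definition pres_class (u : word) : presented := \pi_({eq_quot pres_equiv}) u.
Definition pres_repr (x : presented) : word := repr (x : {eq_quot pres_equiv}).

Lemma pres_classP u v : pres_class u = pres_class v <-> pres_eq u v.
Proof.
split=> [/eqquotP /asboolP // | uv]; apply/eqquotP; exact/asboolP.
Qed.

Lemma pres_reprK x : pres_class (pres_repr x) = x.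
Proof. exact: reprK. Qed.

Lemma pres_repr_class u : pres_eq (pres_repr (pres_class u)) u.
Proof. by apply/pres_classP; rewrite pres_reprK. Qed.

Definition word_inv (u : word) : word := rev [seq (l.1, ~~ l.2) | l <- u].

Lemma pres_eq_invl u : pres_eq (word_inv u ++ u) [::].
Proof.
elim: u => [|[x e] u IHu]; first exact: pres_refl.
rewrite /word_inv map_cons rev_cons -cats1 -catA /=.
apply: pres_trans IHu; apply: pres_cat; first exact: pres_refl.
rewrite -[(x, ~~ e) :: _]/([:: (x, ~~ e); (x, e)] ++ u).
rewrite -[X in pres_eq _ X]cat0s; apply: pres_cat; last exact: pres_refl.
by rewrite -{2}[e]negbK; apply: pres_cancel.
Qed.

Lemma word_invK : involutive word_inv.
Proof.
move=> u; rewrite /word_inv map_rev revK -map_comp map_id_in //.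
by case=> x e _ /=; rewrite negbK.
Qed.

Lemma pres_eq_inv u v : pres_eq u v -> pres_eq (word_inv u) (word_inv v).
Proof.
move=> uv; apply: (@pres_trans (word_inv u ++ (v ++ word_inv v))).
  rewrite -{1}[word_inv u]cats0; apply: pres_cat; first exact: pres_refl.
  apply: pres_sym; rewrite -{1}[v]word_invK; exact: pres_eq_invl.
rewrite catA -[X in pres_eq _ X]cat0s; apply: pres_cat; last exact: pres_refl.
apply: pres_trans (pres_eq_invl u); apply: pres_cat; first exact: pres_refl.
exact: pres_sym.
Qed.

Definition pres_one : presented := pres_class [::].
Definition pres_mul (x y : presented) : presented :=
  pres_class (pres_repr x ++ pres_repr y).
Definition pres_inv (x : presented) : presented :=
  pres_class (word_inv (pres_repr x)).

Lemma pres_mulE u v :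
  pres_mul (pres_class u) (pres_class v) = pres_class (u ++ v).
Proof. by apply/pres_classP/pres_cat; apply: pres_repr_class. Qed.

Lemma pres_invE u : pres_inv (pres_class u) = pres_class (word_inv u).
Proof. by apply/pres_classP/pres_eq_inv/pres_repr_class. Qed.

Lemma pres_mulA : associative pres_mul.
Proof.
move=> x y z; rewrite -(pres_reprK x) -(pres_reprK y) -(pres_reprK z).
by rewrite !pres_mulE catA.
Qed.

Lemma pres_mul1 : left_id pres_one pres_mul.
Proof. by move=> x; rewrite -(pres_reprK x) pres_mulE. Qed.

Lemma pres_mulg1 : right_id pres_one pres_mul.
Proof. by move=> x; rewrite -(pres_reprK x) pres_mulE cats0. Qed.

Lemma pres_mulV : left_inverse pres_one pres_inv pres_mul.
Proof.
move=> x; rewrite -(pres_reprK x) pres_invE pres_mulE.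
exact/pres_classP/pres_eq_invl.
Qed.

Lemma pres_mulgV : right_inverse pres_one pres_inv pres_mul.
Proof.
move=> x; rewrite -(pres_reprK x) pres_invE pres_mulE; apply/pres_classP.
by rewrite -{1}[pres_repr x]word_invK; apply: pres_eq_invl.
Qed.

HB.instance Definition _ := isGroup.Build presented
  pres_mulA pres_mul1 pres_mulg1 pres_mulV pres_mulgV.

End PresentedGroup.

Inductive p2_gen := gen_a | gen_b | gen_r.

Definition p2_gen_code (x : p2_gen) : nat :=
  match x with gen_a => 0 | gen_b => 1 | gen_r => 2 end.
Definition p2_gen_decode (n : nat) : p2_gen :=
  match n with 0 => gen_a | 1 => gen_b | _ => gen_r end.
Lemma p2_gen_codeK : cancel p2_gen_code p2_gen_decode.
Proof. by case. Qed.

HB.instance Definition _ := Choice.copy p2_gen (can_type p2_gen_codeK).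

Section P2Relators.

Let a := (gen_a, false).
Let a' := (gen_a, true).
Let b := (gen_b, false).
Let b' := (gen_b, true).
Let r := (gen_r, false).

Definition p2_relators : set (seq (p2_gen * bool)) :=
  [set u | u = [:: a; b; a'; b'] \/ u = [:: r; r] \/
           u = [:: r; a; r; a] \/ u = [:: r; b; r; b]].

End P2Relators.

Definition p2 : groupType := presented p2_relators.

Record augStarAlg (R : realType) := AugStarAlg {
  asa_alg :> algType R[i];
  asa_star : asa_alg -> asa_alg;
  asa_eps : asa_alg -> R[i];
  asa_starP : forall (c : R[i]) a b,
    asa_star (c *: a + b) = c^* *: asa_star a + asa_star b;
  asa_starK : involutive asa_star;
  asa_starM : forall a b, asa_star (a * b) = asa_star b * asa_star a;
  asa_epsP : forall (c : R[i]) a b,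
    asa_eps (c *: a + b) = c * asa_eps a + asa_eps b;
  asa_eps1 : asa_eps 1 = 1;
  asa_epsM : forall a b, asa_eps (a * b) = asa_eps a * asa_eps b;
  asa_eps_star : forall a, asa_eps (asa_star a) = (asa_eps a)^* }.

Arguments asa_star {R _} _.
Arguments asa_eps {R _} _.

Section FormalSums.
Variables (C : nzRingType) (K : choiceType).
Implicit Types (c d : C) (k : K) (x y : {malg C[K]}).

Lemma malgZU c d k : c *: (<< d *g k >> : {malg C[K]}) = << c * d *g k >>.
Proof. by apply/malgP => l; rewrite mcoeffZ !mcoeffU mulrnAr. Qed.

Lemma malg_ind (P : {malg C[K]} -> Prop) :
  P 0 -> (forall x y, P x -> P y -> P (x + y)) ->
  (forall c k, P << c *g k >>) -> forall x, P x.
Proof. by move=> P0 PD PU x; rewrite [x]monalgE; apply: big_ind. Qed.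

Variables (V : zmodType) (f : K -> C -> V).
Hypothesis fD : forall k c d, f k (c + d) = f k c + f k d.

Definition malg_extend x : V := \sum_(k <- msupp x) f k x@_k.

Let f0 k : f k 0 = 0.
Proof. by apply: (addIr (f k 0)); rewrite -fD !add0r. Qed.

Let malg_extendEw (d : {fset K}) x : (msupp x `<=` d)%fset ->
  malg_extend x = \sum_(k <- d) f k x@_k.
Proof. by move=> xd; apply: big_fset_incl => // k _ /mcoeff_outdom ->. Qed.

Lemma malg_extendD x y : malg_extend (x + y) = malg_extend x + malg_extend y.
Proof.
rewrite (malg_extendEw (msuppD_le x y)).
rewrite (malg_extendEw (fsubsetUl (msupp x) (msupp y))).
rewrite (malg_extendEw (fsubsetUr (msupp x) (msupp y))) -big_split /=.
by apply: eq_bigr => k _; rewrite mcoeffD fD.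
Qed.

Lemma malg_extend0 : malg_extend 0 = 0.
Proof. by rewrite /malg_extend msupp0 big_seq_fset0. Qed.

Lemma malg_extendU c k : malg_extend << c *g k >> = f k c.
Proof. by rewrite (malg_extendEw msuppU_le) big_seq_fset1 mcoeffUU. Qed.

End FormalSums.

Section GroupAlgebra.
Variables (R : realType) (G : groupType).

(* The product that the library puts on [{malg R[i][G]}] is only available for
   monoids without nontrivial units, whence the convolution product below. *)
Definition group_alg : Type := {malg R[i][G]}.
Local Notation A := group_alg.

HB.instance Definition _ := GRing.Lmodule.copy A {malg R[i][G]}.

Implicit Types (x y z : A) (g h : G) (c d : R[i]).

Lemma ga_ind (P : A -> Prop) :
  P 0 -> (forall x y, P x -> P y -> P (x + y)) ->
  (forall c g, P << c *g g >>) -> forall x, P x.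
Proof. exact: malg_ind. Qed.

Definition ga_one : A := << 1%g >>.

Definition ga_mul x y : A :=
  \sum_(g <- msupp x) \sum_(h <- msupp y) << x@_g * y@_h *g (g * h)%g >>.

Definition ga_star x : A := \sum_(g <- msupp x) << (x@_g)^* *g g^-1%g >>.

Definition ga_eps x : R[i] := \sum_(g <- msupp x) x@_g.

Lemma ga_mul0 : right_zero 0 ga_mul.
Proof.
by move=> x; rewrite /ga_mul big1 // => g _; rewrite msupp0 big_seq_fset0.
Qed.

Lemma ga_mulDr : right_distributive ga_mul +%R.
Proof.
move=> x y z; rewrite /ga_mul -big_split /=; apply: eq_bigr => g _.
apply: (@malg_extendD _ _ _ (fun h c => << x@_g * c *g (g * h)%g >> : A)).
by move=> h c d; rewrite mulrDr monalgUD.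
Qed.

Lemma ga_mulDl : left_distributive ga_mul +%R.
Proof.
move=> x y z.
apply: (@malg_extendD _ _ _ (fun g c =>
  \sum_(h <- msupp z) << c * z@_h *g (g * h)%g >> : A)) => g c d.
by rewrite -big_split; apply: eq_bigr => h _; rewrite mulrDl monalgUD.
Qed.

Lemma ga_0mul : left_zero 0 ga_mul.
Proof. by move=> x; rewrite /ga_mul msupp0 big_seq_fset0. Qed.

Lemma ga_mulUU c d g h :
  ga_mul << c *g g >> << d *g h >> = << c * d *g (g * h)%g >>.
Proof.
apply: etrans (@malg_extendU _ _ _ (fun k e =>
  \sum_(l <- msupp (<< d *g h >> : A))
     << e * (<< d *g h >> : A)@_l *g (k * l)%g >> : A) _ c g) _.
  move=> k c' d'; rewrite -big_split; apply: eq_bigr => l _.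
  by rewrite mulrDl monalgUD.
apply: (@malg_extendU _ _ _ (fun l e => << c * e *g (g * l)%g >> : A)).
by move=> k c' d'; rewrite mulrDr monalgUD.
Qed.

Lemma ga_mulA : associative ga_mul.
Proof.
elim/ga_ind => [y z|x x' IHx IHx' y z|c g].
- by rewrite !ga_0mul.
- by rewrite !ga_mulDl IHx IHx'.
elim/ga_ind => [z|y y' IHy IHy' z|d h].
- by rewrite ga_0mul ga_mul0 ga_0mul.
- by rewrite ga_mulDl !ga_mulDr IHy IHy' ga_mulDl.
elim/ga_ind => [|z z' IHz IHz'|e k].
- by rewrite !ga_mul0.
- by rewrite !ga_mulDr IHz IHz'.
by rewrite !ga_mulUU mulrA mulgA.
Qed.

Lemma ga_mul1 : left_id ga_one ga_mul.
Proof.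
elim/ga_ind => [|x y IHx IHy|c g]; first exact: ga_mul0.
  by rewrite ga_mulDr IHx IHy.
by rewrite ga_mulUU mul1r mul1g.
Qed.

Lemma ga_mulr1 : right_id ga_one ga_mul.
Proof.
elim/ga_ind => [|x y IHx IHy|c g]; first exact: ga_0mul.
  by rewrite ga_mulDl IHx IHy.
by rewrite ga_mulUU mulr1 mulg1.
Qed.

Lemma ga_one_neq0 : ga_one != 0.
Proof. by rewrite monalgU_eq0 oner_eq0. Qed.

HB.instance Definition _ := GRing.Zmodule_isNzRing.Build A
  ga_mulA ga_mul1 ga_mulr1 ga_mulDl ga_mulDr ga_one_neq0.

Lemma ga_basisM c d g h :
  (<< c *g g >> : A) * (<< d *g h >> : A) = << c * d *g (g * h)%g >>.
Proof. exact: ga_mulUU. Qed.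

Lemma ga_basisZ c d g : c *: (<< d *g g >> : A) = << c * d *g g >>.
Proof. exact: malgZU. Qed.

Lemma ga_scaleAl c x y : c *: (x * y) = (c *: x) * y.
Proof.
elim/ga_ind: x => [|x x' IHx IHx'|d g].
- by rewrite !(mul0r, scaler0).
- by rewrite mulrDl !scalerDr IHx IHx' mulrDl.
elim/ga_ind: y => [|y y' IHy IHy'|e h].
- by rewrite !mulr0 scaler0.
- by rewrite !mulrDr scalerDr IHy IHy'.
by rewrite ga_basisM !ga_basisZ ga_basisM mulrA.
Qed.

HB.instance Definition _ := GRing.Lmodule_isLalgebra.Build R[i] A ga_scaleAl.

Lemma ga_scaleAr c x y : c *: (x * y) = x * (c *: y).
Proof.
elim/ga_ind: x => [|x x' IHx IHx'|d g].
- by rewrite !(mul0r, scaler0).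
- by rewrite !mulrDl scalerDr IHx IHx'.
elim/ga_ind: y => [|y y' IHy IHy'|e h].
- by rewrite scaler0 mulr0 scaler0.
- by rewrite mulrDr !scalerDr mulrDr IHy IHy'.
by rewrite ga_basisM !ga_basisZ ga_basisM mulrCA.
Qed.

HB.instance Definition _ := GRing.Lalgebra_isAlgebra.Build R[i] A ga_scaleAr.

Let starD g c d :
  << (c + d)^* *g g^-1%g >> = << c^* *g g^-1%g >> + << d^* *g g^-1%g >> :> A.
Proof. by rewrite rmorphD monalgUD. Qed.

Lemma ga_starU c g : ga_star << c *g g >> = << c^* *g g^-1%g >>.
Proof. exact: (malg_extendU starD). Qed.

Lemma ga_starD x y : ga_star (x + y) = ga_star x + ga_star y.
Proof. exact: (malg_extendD starD). Qed.

Lemma ga_star0 : ga_star 0 = 0.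
Proof. exact: (@malg_extend0 _ _ _ (fun g c => << c^* *g g^-1%g >> : A)). Qed.

Lemma ga_starZ c x : ga_star (c *: x) = c^* *: ga_star x.
Proof.
elim/ga_ind: x => [|x x' IHx IHx'|d g]; first by rewrite !(scaler0, ga_star0).
  rewrite (scalerDr c x) (ga_starD (c *: x)) (ga_starD x) scalerDr.
  by congr (_ + _); [exact: IHx | exact: IHx'].
by rewrite ga_basisZ !ga_starU ga_basisZ rmorphM.
Qed.

Lemma ga_starP c x y : ga_star (c *: x + y) = c^* *: ga_star x + ga_star y.
Proof. by rewrite (ga_starD (c *: x)) ga_starZ. Qed.

Lemma ga_starK : involutive ga_star.
Proof.
elim/ga_ind => [|x y IHx IHy|c g]; first by rewrite !ga_star0.
  by rewrite !ga_starD IHx IHy.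
by rewrite !ga_starU conjCK invgK.
Qed.

Lemma ga_starM x y : ga_star (x * y) = ga_star y * ga_star x.
Proof.
elim/ga_ind: x => [|x x' IHx IHx'|c g].
- by rewrite mul0r ga_star0 mulr0.
- by rewrite mulrDl !ga_starD mulrDr IHx IHx'.
elim/ga_ind: y => [|y y' IHy IHy'|d h].
- by rewrite mulr0 ga_star0 mul0r.
- by rewrite mulrDr !ga_starD mulrDl IHy IHy'.
by rewrite !ga_starU !ga_basisM ga_starU rmorphM mulrC invgM.
Qed.

Lemma ga_epsU c g : ga_eps << c *g g >> = c.
Proof. exact: (@malg_extendU _ _ _ (fun _ c => c)). Qed.

Lemma ga_epsD x y : ga_eps (x + y) = ga_eps x + ga_eps y.
Proof. exact: (@malg_extendD _ _ _ (fun _ c => c)). Qed.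

Lemma ga_eps0 : ga_eps 0 = 0.
Proof. exact: (@malg_extend0 _ _ _ (fun _ c => c)). Qed.

Lemma ga_epsZ c x : ga_eps (c *: x) = c * ga_eps x.
Proof.
elim/ga_ind: x => [|x x' IHx IHx'|d g]; first by rewrite scaler0 ga_eps0 mulr0.
  rewrite (scalerDr c x) (ga_epsD (c *: x)) (ga_epsD x) mulrDr.
  by congr (_ + _); [exact: IHx | exact: IHx'].
by rewrite ga_basisZ !ga_epsU.
Qed.

Lemma ga_epsP c x y : ga_eps (c *: x + y) = c * ga_eps x + ga_eps y.
Proof. by rewrite (ga_epsD (c *: x)) ga_epsZ. Qed.

Lemma ga_eps1 : ga_eps 1 = 1.
Proof. exact: ga_epsU. Qed.

Lemma ga_epsM x y : ga_eps (x * y) = ga_eps x * ga_eps y.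
Proof.
elim/ga_ind: x => [|x x' IHx IHx'|c g].
- by rewrite mul0r ga_eps0 mul0r.
- by rewrite mulrDl !ga_epsD mulrDl IHx IHx'.
elim/ga_ind: y => [|y y' IHy IHy'|d h].
- by rewrite mulr0 ga_eps0 mulr0.
- by rewrite mulrDr !ga_epsD mulrDr IHy IHy'.
by rewrite ga_basisM !ga_epsU.
Qed.

Lemma ga_eps_star x : ga_eps (ga_star x) = (ga_eps x)^*.
Proof.
elim/ga_ind: x => [|x y IHx IHy|c g].
- by rewrite ga_star0 ga_eps0 rmorph0.
- by rewrite ga_starD !ga_epsD IHx IHy rmorphD.
by rewrite ga_starU !ga_epsU.
Qed.

Definition group_star_alg : augStarAlg R := @AugStarAlg R A ga_star ga_eps
  ga_starP ga_starK ga_starM ga_epsP ga_eps1 ga_epsM ga_eps_star.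

End GroupAlgebra.

Record preHilbert (R : realType) := PreHilbert {
  ph_space :> lmodType R[i];
  ph_dot : {dot ph_space for Num.conj} }.

(* The form [ph_dot] of the library is linear in its first argument, whereas
   the inner product is taken to be linear in the second one. *)
Definition ip (R : realType) (D : preHilbert R) (v w : D) : R[i] :=
  ph_dot D w v.

Definition ip_norm (R : realType) (D : preHilbert R) (v : D) : R :=
  Num.sqrt (complex.Re (ip v v)).

Definition is_adjoint (R : realType) (D : preHilbert R) (T S : D -> D) :=
  forall v w, ip (S v) w = ip v (T w).

(* Adjoints being unique, [starRep_adj] says that each [pi a] belongs to L(D)
   and that its adjoint in L(D) is [pi (asa_star a)]. *)
Record starRep (R : realType) (A : augStarAlg R) (D : preHilbert R) :=
  StarRep {
  starRep_fun :> A -> D -> D;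
  starRep_op : forall a, linear (starRep_fun a);
  starRep_lin : forall c a b v,
    starRep_fun (c *: a + b) v = c *: starRep_fun a v + starRep_fun b v;
  starRep_1 : forall v, starRep_fun 1 v = v;
  starRep_M : forall a b v,
    starRep_fun (a * b) v = starRep_fun a (starRep_fun b v);
  starRep_adj : forall a,
    is_adjoint (starRep_fun a) (starRep_fun (asa_star a)) }.

Record cocycle (R : realType) (A : augStarAlg R) (D : preHilbert R)
    (pi : starRep A D) := Cocycle {
  cocycle_fun :> {linear A -> D};
  cocycleP : forall a b,
    cocycle_fun (a * b) = pi a (cocycle_fun b) + asa_eps b *: cocycle_fun a }.

Definition schurmann_triple (R : realType) (A : augStarAlg R)
    (D : preHilbert R) (pi : starRep A D) (eta : cocycle pi)
    (psi : {scalar A}) : Prop :=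
  (forall a, psi (asa_star a) = (psi a)^*) /\
  (forall a b, asa_eps a * psi b - psi (a * b) + psi a * asa_eps b =
               - ip (eta (asa_star a)) (eta b)).

Definition admits_generating_functional (R : realType) (A : augStarAlg R)
    (D : preHilbert R) (pi : starRep A D) (eta : cocycle pi) : Prop :=
  exists psi : {scalar A}, schurmann_triple eta psi.

Section CocycleRange.
Variables (R : realType) (A : augStarAlg R) (D : preHilbert R).
Variables (pi : starRep A D) (eta : cocycle pi).

Definition cocycle_range_pred : pred D := fun v => `[< exists a, eta a = v >].

Fact cocycle_range_submod : submod_closed cocycle_range_pred.
Proof.
split=> [|c u v /asboolP[a <-] /asboolP[b <-]]; apply/asboolP.
  by exists 0; rewrite linear0.
by exists (c *: a + b); rewrite linearP.
Qed.

HB.instance Definition _ :=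
  GRing.isSubmodClosed.Build R[i] D cocycle_range_pred cocycle_range_submod.

Record cocycle_range_type := CocycleRange {
  cocycle_range_val :> D; _ : cocycle_range_val \in cocycle_range_pred }.

HB.instance Definition _ := [isSub for cocycle_range_val].
HB.instance Definition _ := [Choice of cocycle_range_type by <:].
HB.instance Definition _ :=
  [SubChoice_isSubLmodule of cocycle_range_type by <:].

Definition cocycle_range_dot (u v : cocycle_range_type) : R[i] :=
  ph_dot D (\val u) (\val v).

Fact cocycle_range_dot_bilinear :
  bilinear_for *%R (Num.conj \; *%R) cocycle_range_dot.
Proof.
split=> u c v w; rewrite /cocycle_range_dot (linearP val).
  by rewrite linearDl linearZl_LR.
by rewrite linearDr linearZr_LR.
Qed.

HB.instance Definition _ := bilinear_isBilinear.Build R[i]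
  cocycle_range_type cocycle_range_type R[i] *%R (Num.conj \; *%R)
  cocycle_range_dot cocycle_range_dot_bilinear.

Fact cocycle_range_dot_hermitian u v :
  cocycle_range_dot u v = (-1) ^+ false * Num.conj (cocycle_range_dot v u).
Proof. exact: hermitian_subproof. Qed.

HB.instance Definition _ := isHermitianSesquilinear.Build R[i]
  cocycle_range_type false Num.conj cocycle_range_dot
  cocycle_range_dot_hermitian.

Fact cocycle_range_dot_gt0 u : u != 0 -> 0 < cocycle_range_dot u u.
Proof.
move=> u0; apply: neq0_dnorm_gt0.
by apply: contra_neq u0 => u0; apply: val_inj; rewrite u0 linear0.
Qed.

HB.instance Definition _ := isDotProduct.Build R[i]
  cocycle_range_type cocycle_range_dot cocycle_range_dot_gt0.

Definition cocycle_range : preHilbert R :=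
  @PreHilbert R cocycle_range_type cocycle_range_dot.

Fact cocycle_range_stable a (v : cocycle_range) :
  pi a (\val v) \in cocycle_range_pred.
Proof.
have /asboolP[b <-] := valP v; apply/asboolP; exists (a * b - asa_eps b *: a).
by rewrite linearB linearZ cocycleP addrK.
Qed.

Fact cocycle_range_valP c (u v : cocycle_range) :
  \val (c *: u + v) = c *: \val u + \val v.
Proof. exact: (linearP val). Qed.

Definition cocycle_restrict_fun a (v : cocycle_range) : cocycle_range :=
  CocycleRange (cocycle_range_stable a v).

Fact cocycle_restrict_op a : linear (cocycle_restrict_fun a).
Proof.
move=> c u v; apply: val_inj; rewrite cocycle_range_valP /=.
by rewrite -starRep_op -cocycle_range_valP.
Qed.

Fact cocycle_restrict_lin c a b v :
  cocycle_restrict_fun (c *: a + b) v =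
  c *: cocycle_restrict_fun a v + cocycle_restrict_fun b v.
Proof. by apply: val_inj; rewrite cocycle_range_valP /= starRep_lin. Qed.

Fact cocycle_restrict_1 v : cocycle_restrict_fun 1 v = v.
Proof. by apply: val_inj; rewrite /= starRep_1. Qed.

Fact cocycle_restrict_M a b v :
  cocycle_restrict_fun (a * b) v =
  cocycle_restrict_fun a (cocycle_restrict_fun b v).
Proof. by apply: val_inj; rewrite /= starRep_M. Qed.

Fact cocycle_restrict_adj a :
  is_adjoint (cocycle_restrict_fun a) (cocycle_restrict_fun (asa_star a)).
Proof. by move=> v w; apply: (starRep_adj pi a). Qed.

Definition cocycle_restrict : starRep A cocycle_range := StarRep
  cocycle_restrict_op cocycle_restrict_lin cocycle_restrict_1
  cocycle_restrict_M cocycle_restrict_adj.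

End CocycleRange.

Section Completion.
Variable R : realType.

Definition ip_cauchy (D : preHilbert R) (u : nat -> D) : Prop :=
  forall e : R, 0 < e ->
  exists N, forall m n, (N <= m)%N -> (N <= n)%N -> ip_norm (u m - u n) < e.

Definition ip_converges (D : preHilbert R) (u : nat -> D) (l : D) : Prop :=
  forall e : R, 0 < e ->
  exists N, forall n, (N <= n)%N -> ip_norm (u n - l) < e.

Record completion (D : preHilbert R) := Completion {
  cpl_space :> preHilbert R;
  cpl_complete : forall u : nat -> cpl_space,
    ip_cauchy u -> exists l, ip_converges u l;
  cpl_inj : {linear D -> cpl_space};
  cpl_inj_isometry : forall v w, ip (cpl_inj v) (cpl_inj w) = ip v w;
  cpl_inj_dense : forall (h : cpl_space) (e : R), 0 < e ->
    exists v, ip_norm (h - cpl_inj v) < e }.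

Definition ip_ortho (H : preHilbert R) (S : set H) : set H :=
  [set h | forall s, S s -> ip s h = 0].

(* [p] is the orthogonal projection of [h] onto [S]; by the projection theorem
   it exists whenever [S] is a closed subspace of a complete space. *)
Definition is_ortho_proj (H : preHilbert R) (S : set H) (h p : H) : Prop :=
  S p /\ ip_ortho S (h - p).

End Completion.

Section NonGaussian.
Variables (R : realType) (A : augStarAlg R).

Definition gaussian_space (D : preHilbert R) (pi : starRep A D)
    (H : completion D) : set H :=
  ip_ortho [set h | exists a v, h = cpl_inj H (pi a v - asa_eps a *: v)].

Arguments gaussian_space {D} pi H _.

Definition gaussian_part (D : preHilbert R) (pi : starRep A D)
    (H : completion D) : set H :=
  [set p | exists v : D, is_ortho_proj (gaussian_space pi H) (cpl_inj H v) p].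

Arguments gaussian_part {D} pi H _.

(* The representation is first restricted to the range of the cocycle.
   Completions exist and are unique up to unitary equivalence, so that it does
   not matter which one is used. *)
Definition non_gaussian (D : preHilbert R) (pi : starRep A D)
    (eta : cocycle pi) : Prop :=
  exists H : completion (cocycle_range eta),
    gaussian_part (cocycle_restrict eta) H = [set 0]%classic.

Definition property_NC : Prop :=
  forall (D : preHilbert R) (pi : starRep A D) (eta : cocycle pi),
  non_gaussian eta -> admits_generating_functional eta.

Definition property_AC : Prop :=
  forall (D : preHilbert R) (pi : starRep A D) (eta : cocycle pi),
  admits_generating_functional eta.

End NonGaussian.

Arguments property_NC {R} A.
Arguments property_AC {R} A.

(* Main.v *)
Require Import Defs.
From mathcomp Require Import all_boot reals.
From HB Require Import structures.
From mathcomp Require Import all_order all_algebra.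
From mathcomp Require Import complex boolp classical_sets.
From mathcomp Require Import topology normedtype.
From mathcomp.multinomials Require monalg.
From mathcomp Require Import ring.

(** The group [p2] acts on the complex plane by rigid motions: [a] and [b] are
the translations by [1] and ['i], and [r] is the rotation [z |-> - z].  Every
[g] therefore acts as [z |-> p2_sign g * z + p2_origin g] with
[p2_sign g = 1] or [-1].  The linear part [p2_sign] is a one-dimensional unitary
representation, and the orbit map [p2_origin] of the origin is a cocycle for it
([p2_cocycle]).

This cocycle is purely non-Gaussian ([p2_cocycle_non_gaussian]), since [r] acts
on the line as [-1] whereas [eps r = 1], so that the range of [pi r - eps r] is
the whole line.

It has no generating functional ([p2_cocycle_no_functional]).  If [psi] were
one, then the equation of a Schuermann triple expresses [psi (x * y)] as a term
symmetric in [x] and [y] plus [ip (eta x^* ) (eta y)]; hence this inner product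
is symmetric in [x] and [y] whenever they commute
([generating_functional_comm]).  The commuting translations [a] and [b] give
[- 'i] in one order and ['i] in the other: the restriction of [eta] to the
lattice is a Gaussian cocycle whose values [1] and ['i] have an inner product
that is not real, which is the obstruction, and the rotation [r] hides this
Gaussian behaviour without removing it. *)

Set Implicit Arguments.
Unset Strict Implicit.
Unset Printing Implicit Defensive.

Import Order.TTheory GRing.Theory Num.Theory.
Import numFieldNormedType.Exports.
Local Open Scope ring_scope.

(** * Actions of presented groups *)

Section PresentedGroupAction.
Variables (X : choiceType) (rels : set (seq (X * bool))) (T : Type).
Variable act : X * bool -> T -> T.
Hypothesis act_cancel : forall x e z, act (x, e) (act (x, ~~ e) z) = z.
Hypothesis act_rel : forall u, rels u -> forall z, foldr act z u = z.

(** The universal property of a presentation, for actions: an action of the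
free monoid of words that respects cancellation and the relators factors
through the presented group. *)
Lemma pres_eq_foldr u v :
  pres_eq rels u v -> forall z, foldr act z u = foldr act z v.
Proof.
elim=> {u v} //= [v u w _ IHuv _ IHvw z|u u' v v' _ IHu _ IHv z].
- by rewrite IHuv IHvw.
- by rewrite !foldr_cat IHv IHu.
Qed.

Definition pres_act (x : presented rels) (z : T) : T :=
  foldr act z (pres_repr x).

Lemma pres_act_class u z : pres_act (pres_class rels u) z = foldr act z u.
Proof. exact/pres_eq_foldr/pres_repr_class. Qed.

Lemma pres_actM (x y : presented rels) z :
  pres_act (x * y)%g z = pres_act x (pres_act y z).
Proof. by rewrite pres_act_class foldr_cat. Qed.

Lemma pres_act1 z : pres_act 1%g z = z.
Proof. exact: pres_act_class. Qed.

End PresentedGroupAction.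

Lemma pres_class_cat (X : choiceType) (rels : set (seq (X * bool))) u v :
  pres_class rels (u ++ v) = (pres_class rels u * pres_class rels v)%g.
Proof. exact/esym/pres_mulE. Qed.

Lemma pres_class_inv (X : choiceType) (rels : set (seq (X * bool))) u :
  pres_class rels (word_inv u) = (pres_class rels u)^-1%g.
Proof. exact/esym/pres_invE. Qed.

(** * The complex line as a Hilbert space *)

Section Line.
Variable R : realType.

Definition line_dot (u v : R[i]^o) : R[i] := (u : R[i]) * (v : R[i])^*.

Fact line_dot_bilinear : bilinear_for *%R (Num.conj \; *%R) line_dot.
Proof.
split=> u c v w; rewrite /line_dot; first by rewrite mulrDl -mulrA.
by rewrite rmorphD rmorphM mulrDr mulrCA.
Qed.

HB.instance Definition _ := bilinear_isBilinear.Build R[i]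
  R[i]^o R[i]^o R[i] *%R (Num.conj \; *%R) line_dot line_dot_bilinear.

Fact line_dot_hermitian u v :
  line_dot u v = (-1) ^+ false * Num.conj (line_dot v u).
Proof.
rewrite expr0 mul1r /line_dot rmorphM mulrC.
by congr (_ * _); apply/esym/conjCK.
Qed.

HB.instance Definition _ := isHermitianSesquilinear.Build R[i]
  R[i]^o false Num.conj line_dot line_dot_hermitian.

Fact line_dot_gt0 u : u != 0 -> 0 < line_dot u u.
Proof. by rewrite /line_dot mul_conjC_gt0. Qed.

HB.instance Definition _ := isDotProduct.Build R[i]
  R[i]^o line_dot line_dot_gt0.

Definition line : preHilbert R := @PreHilbert R R[i]^o line_dot.

Lemma line_ipE (u v : line) : ip u v = (v : R[i]) * (u : R[i])^*.
Proof. by []. Qed.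

Lemma line_normE (v : line) :
  ip_norm v = Num.sqrt (complex.Re v ^+ 2 + complex.Im v ^+ 2).
Proof. by rewrite /ip_norm line_ipE -normCK -add_Re2_Im2. Qed.

Lemma line_norm_ge_Re (v : line) : `|complex.Re v| <= ip_norm v.
Proof. by rewrite line_normE -sqrtr_sqr ler_wsqrtr // lerDl sqr_ge0. Qed.

Lemma line_norm_ge_Im (v : line) : `|complex.Im v| <= ip_norm v.
Proof. by rewrite line_normE -sqrtr_sqr ler_wsqrtr // lerDr sqr_ge0. Qed.

Lemma line_norm_le (v : line) :
  ip_norm v <= `|complex.Re v| + `|complex.Im v|.
Proof.
rewrite line_normE -[leRHS]ger0_norm ?addr_ge0 // -sqrtr_sqr ler_wsqrtr //.
rewrite sqrrD !real_normK ?num_real // lerD2r lerDl.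
by rewrite mulrn_wge0 ?mulr_ge0.
Qed.

Lemma real_cauchy_seq (x : nat -> R) :
  (forall e, 0 < e -> exists N, forall m n,
     (N <= m)%N -> (N <= n)%N -> `|x m - x n| < e) ->
  exists l, forall e, 0 < e -> exists N, forall n,
     (N <= n)%N -> `|x n - l| < e.
Proof.
move=> xC; have /cauchy_cvgP/cvg_ex[l xl] : cauchy (x @ \oo)%classic.
  apply/cauchy_exP => e /xC[N NxC]; exists (x N); exists N => //= n Nn.
  exact: NxC.
exists l => e e0; have /cvgrPdistC_lt/(_ e e0)[N _ xN] := xl.
by exists N => n; apply: xN.
Qed.

(** The norm is the modulus, which dominates both coordinates and is dominated
by the sum of their absolute values; so convergence is coordinatewise. *)
Lemma line_complete (u : nat -> line) :
  ip_cauchy u -> exists l, ip_converges u l.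
Proof.
move=> uC.
have [|x xl] := @real_cauchy_seq (fun n => complex.Re (u n)).
  move=> e /uC[N NuC]; exists N => m n Nm Nn.
  apply: le_lt_trans (NuC m n Nm Nn); rewrite -raddfB; exact: line_norm_ge_Re.
have [|y yl] := @real_cauchy_seq (fun n => complex.Im (u n)).
  move=> e /uC[N NuC]; exists N => m n Nm Nn.
  apply: le_lt_trans (NuC m n Nm Nn); rewrite -raddfB; exact: line_norm_ge_Im.
exists (x +i* y)%C => e e0; have e2 : 0 < e / 2 by rewrite divr_gt0.
have [N xN] := xl _ e2; have [M yM] := yl _ e2.
exists (maxn N M) => n; rewrite geq_max => /andP[Nn Mn].
apply: le_lt_trans (line_norm_le _) _.
rewrite [e]splitr ltrD //; first by rewrite raddfB; apply: xN.
by rewrite raddfB; apply: yM.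
Qed.

End Line.

(** * The obstruction to a generating functional *)

Section Obstruction.
Variables (R : realType) (A : augStarAlg R) (D : preHilbert R).
Variables (pi : starRep A D) (eta : cocycle pi).

(** In the equation of a Schuermann triple all terms but the inner product are
symmetric under the exchange of two commuting elements. *)
Lemma generating_functional_comm (a b : A) :
  admits_generating_functional eta -> a * b = b * a ->
  ip (eta (asa_star a)) (eta b) = ip (eta (asa_star b)) (eta a).
Proof.
move=> [psi [_ psiP]] ab; apply: oppr_inj; rewrite -!psiP ab.
by ring.
Qed.

End Obstruction.

(** * Cocycles onto the line *)

Section LineCocycle.
Variables (R : realType) (A : augStarAlg R) (pi : starRep A (line R)).
Variable eta : cocycle pi.
Hypothesis eta_surj : forall z : line R, exists a, eta a = z.

Definition range_in_line : cocycle_range eta -> line R := fun v => \val v.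

Fact range_in_line_linear : linear range_in_line.
Proof. exact: cocycle_range_valP. Qed.

HB.instance Definition _ := GRing.isLinear.Build R[i] (cocycle_range eta)
  (line R) *:%R range_in_line range_in_line_linear.

Fact range_in_line_dense (h : line R) (e : R) : 0 < e ->
  exists v, ip_norm (h - range_in_line v) < e.
Proof.
move=> e0; have [a ah] := eta_surj h.
have hP : h \in cocycle_range_pred eta by apply/asboolP; exists a.
exists (CocycleRange hP); rewrite /range_in_line /= subrr line_normE /=.
by rewrite expr0n addr0 sqrtr0.
Qed.

(** Since [eta] is onto and the line is complete, the line itself serves as the
completion of the range of [eta]. *)
Definition range_completion : completion (cocycle_range eta) :=
  @Completion R _ (line R) (@line_complete R) range_in_line
    (fun _ _ => erefl) range_in_line_dense.

(** The vector [(c - asa_eps a) *: 1] spans the line and has the form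
[pi a v - asa_eps a *: v], so that only [0] is orthogonal to all such vectors. *)
Lemma line_non_gaussian (a : A) (c : R[i]) :
  (forall v, pi a v = c *: v) -> c != asa_eps a -> non_gaussian eta.
Proof.
move=> piac ca; exists range_completion; apply/seteqP; split=> [p|p ->] /=.
  case=> v [Sp _].
  have [b b1] := eta_surj (1 : R[i]).
  have oneP : (1 : R[i]) \in cocycle_range_pred eta by apply/asboolP; exists b.
  pose w : cocycle_range eta := CocycleRange oneP.
  have := Sp (pi a (1 : R[i]) - asa_eps a *: (1 : R[i]^o)).
  rewrite piac -scalerBl line_ipE => Sp1.
  have /Sp1/eqP : exists b' v', (c - asa_eps a) *: (1 : R[i]^o) = cpl_inj
      range_completion (cocycle_restrict eta b' v' - asa_eps b' *: v').
    by exists a, w; rewrite scalerBl -piac linearB linearZ.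
  rewrite mulf_eq0 conjC_eq0.
  by rewrite scaler_eq0 oner_eq0 orbF subr_eq0 (negbTE ca) orbF => /eqP.
exists 0; split => [s _|s _]; first by rewrite line_ipE mul0r.
by rewrite linear0 subr0 line_ipE mul0r.
Qed.

End LineCocycle.

(** * From group cocycles to cocycles of the group algebra *)

Section GroupCocycle.
Variables (R : realType) (G : groupType).
Local Notation CG := (group_star_alg R G).
Local Notation "c %:[ g ]" := (monalg.mkmalgU g c : CG)
  (at level 2, format "c %:[ g ]").

Definition ga_extend (f : G -> R[i]) (x : CG) : R[i] :=
  malg_extend (fun g c => c * f g) x.

Lemma ga_extendD f : {morph ga_extend f : x y / x + y}.
Proof. by apply: malg_extendD => g c d; rewrite mulrDl. Qed.

Lemma ga_extendU f c g : ga_extend f c%:[g] = c * f g.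
Proof. by apply: malg_extendU => h d e; rewrite mulrDl. Qed.

Lemma ga_extend0 f : ga_extend f 0 = 0.
Proof. exact: malg_extend0. Qed.

Lemma ga_extend_scalar f : scalar (ga_extend f).
Proof.
move=> c x y; rewrite ga_extendD; congr (_ + _).
elim/ga_ind: x => [|x x' IHx IHx'|d g].
- by rewrite scaler0 ga_extend0 mulr0.
- rewrite (scalerDr c x) (ga_extendD f (c *: x)) (ga_extendD f x) mulrDr.
  by congr (_ + _); [exact: IHx | exact: IHx'].
by rewrite ga_basisZ !ga_extendU mulrA.
Qed.

Variables chi t : G -> R[i].
Hypothesis chi1 : chi 1%g = 1.
Hypothesis chiM : forall g h, chi (g * h)%g = chi g * chi h.
Hypothesis chiV : forall g, chi g^-1%g = (chi g)^*.
Hypothesis tM : forall g h, t (g * h)%g = chi g * t h + t g.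

(** Both sides of each identity of a representation and of a cocycle are
additive in every argument, so that it suffices to know [chi] and [t] on group
elements and to check the identities there. *)
Definition character_op (x : CG) (v : line R) : line R :=
  ga_extend chi x * (v : R[i]).

Fact character_op_linear x : linear (character_op x).
Proof. by move=> c u v; rewrite /character_op mulrDr mulrCA. Qed.

Fact character_op_lin c x y v :
  character_op (c *: x + y) v = c *: character_op x v + character_op y v.
Proof. by rewrite /character_op ga_extend_scalar mulrDl -mulrA. Qed.

Fact character_op1 v : character_op 1 v = v.
Proof. by rewrite /character_op ga_extendU chi1 !mul1r. Qed.

Fact character_opM x y v :
  character_op (x * y) v = character_op x (character_op y v).
Proof.
rewrite /character_op mulrA; congr (_ * _).
elim/ga_ind: x => [|x x' IHx IHx'|c g].
- by rewrite mul0r !ga_extend0 mul0r.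
- by rewrite mulrDl !ga_extendD IHx IHx' mulrDl.
elim/ga_ind: y => [|y y' IHy IHy'|d h].
- by rewrite mulr0 !ga_extend0 mulr0.
- by rewrite mulrDr !ga_extendD IHy IHy' mulrDr.
by rewrite ga_basisM !ga_extendU chiM mulrACA.
Qed.

Fact character_op_adj x :
  is_adjoint (character_op x) (character_op (asa_star x)).
Proof.
move=> v w; rewrite !line_ipE /character_op rmorphM mulrCA mulrA.
congr (_ * _ * _).
elim/ga_ind: x => [|x y IHx IHy|c g].
- by rewrite [asa_star _]ga_star0 ga_extend0 rmorph0.
- by rewrite [asa_star _]ga_starD !ga_extendD rmorphD IHx IHy.
by rewrite [asa_star _]ga_starU !ga_extendU chiV -rmorphM; apply: conjCK.
Qed.

Definition character_rep : starRep CG (line R) := StarRep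
  character_op_linear character_op_lin character_op1 character_opM
  character_op_adj.

Definition group_cocycle_fun (x : CG) : line R := ga_extend t x.

HB.instance Definition _ := GRing.isLinear.Build R[i] CG (line R) *:%R
  group_cocycle_fun (ga_extend_scalar t).

Fact group_cocycleP x y : group_cocycle_fun (x * y) =
  character_rep x (group_cocycle_fun y) + asa_eps y *: group_cocycle_fun x.
Proof.
suff: ga_extend t (x * y) =
  ga_extend chi x * ga_extend t y + ga_eps y * ga_extend t x by [].
elim/ga_ind: x => [|x x' IHx IHx'|c g].
- by rewrite mul0r !ga_extend0 mul0r mulr0 addr0.
- by rewrite mulrDl !ga_extendD IHx IHx' mulrDl mulrDr addrACA.
elim/ga_ind: y => [|y y' IHy IHy'|d h].
- by rewrite mulr0 !ga_extend0 ga_eps0 mulr0 mul0r addr0.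
- by rewrite mulrDr !ga_extendD IHy IHy' ga_epsD mulrDl mulrDr addrACA.
rewrite ga_basisM ga_epsU !ga_extendU tM mulrDr mulrACA.
by congr (_ + _); rewrite mulrCA mulrA.
Qed.

Definition group_cocycle : cocycle character_rep := Cocycle group_cocycleP.

Lemma group_cocycleU c g : group_cocycle c%:[g] = c * t g.
Proof. exact: ga_extendU. Qed.

Lemma character_repU c g v : character_rep c%:[g] v = (c * chi g) *: v.
Proof. by rewrite /= /character_op ga_extendU. Qed.

Lemma group_cocycle_ip g h :
  ip (group_cocycle (asa_star 1%:[g])) (group_cocycle 1%:[h]) =
  t h * (t g^-1%g)^*.
Proof.
rewrite [asa_star _]ga_starU rmorph1.
by rewrite [LHS]line_ipE !group_cocycleU !mul1r.
Qed.

End GroupCocycle.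

(** * The wallpaper group acting on the plane *)

Section P2.
Variable R : realType.
Local Notation C := R[i].

(** The boolean marks inverses; the rotation by a half turn is its own
inverse. *)
Definition p2_move (l : p2_gen * bool) (z : C) : C :=
  match l with
  | (gen_a, e) => z + (-1) ^+ e
  | (gen_b, e) => z + (-1) ^+ e * 'i
  | (gen_r, _) => - z
  end.

Fact p2_move_cancel x e z : p2_move (x, e) (p2_move (x, ~~ e) z) = z.
Proof. by case: x e => [] [] /=; rewrite ?expr0 ?expr1; ring. Qed.

Fact p2_move_relators u : p2_relators u -> forall z, foldr p2_move z u = z.
Proof. by case=> [|[|[]]] -> z /=; rewrite ?expr0 ?expr1; ring. Qed.

Lemma p2_move_affine u : exists s : bool, forall z,
  foldr p2_move z u = (-1) ^+ s * z + foldr p2_move 0 u.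
Proof.
elim: u => [|[x e] u [s IHu]] /=.
  by exists false => z; rewrite expr0 mul1r addr0.
case: x.
- by exists s => z; rewrite IHu addrA.
- by exists s => z; rewrite IHu addrA.
- by exists (~~ s) => z; rewrite IHu signrN opprD mulNr.
Qed.

Definition p2_act (g : p2) : C -> C := pres_act p2_move g.

(** The translation part and the linear part of the rigid motion [p2_act g]. *)
Definition p2_origin (g : p2) : C := p2_act g 0.
Definition p2_sign (g : p2) : C := p2_act g 1 - p2_act g 0.

Lemma p2_actM g h z : p2_act (g * h)%g z = p2_act g (p2_act h z).
Proof. exact: pres_actM p2_move_cancel p2_move_relators _ _ _. Qed.

Lemma p2_act1 z : p2_act 1%g z = z.
Proof. exact: pres_act1 p2_move_cancel p2_move_relators _. Qed.

Lemma p2_actE g z : p2_act g z = p2_sign g * z + p2_origin g.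
Proof.
rewrite /p2_sign /p2_origin /p2_act /pres_act.
have [s sP] := p2_move_affine (pres_repr g).
by rewrite (sP 1) mulr1 addrK sP.
Qed.

Lemma p2_sign1 : p2_sign 1%g = 1.
Proof. by rewrite /p2_sign !p2_act1 subr0. Qed.

Lemma p2_signM g h : p2_sign (g * h)%g = p2_sign g * p2_sign h.
Proof. by rewrite /p2_sign !p2_actM !(p2_actE g); ring. Qed.

Lemma p2_signV g : p2_sign g^-1%g = (p2_sign g)^*.
Proof.
have sV : p2_sign g^-1%g * p2_sign g = 1 by rewrite -p2_signM mulVg p2_sign1.
(* Signs are their own inverses and their own conjugates. *)
have [s sE] : exists s : bool, p2_sign g = (-1) ^+ s.
  have [s sP] := p2_move_affine (pres_repr g).
  by exists s; rewrite /p2_sign /p2_act /pres_act sP mulr1 addrK.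
have ss : p2_sign g * p2_sign g = 1 by rewrite sE -expr2 sqrr_sign.
rewrite [in RHS]sE rmorph_sign -sE.
by rewrite -[LHS]mulr1 -[in LHS]ss mulrA sV mul1r.
Qed.

Lemma p2_originM g h :
  p2_origin (g * h)%g = p2_sign g * p2_origin h + p2_origin g.
Proof. by rewrite /p2_origin p2_actM p2_actE. Qed.

Definition p2_rep := character_rep p2_sign1 p2_signM p2_signV.
Definition p2_cocycle : cocycle p2_rep :=
  group_cocycle p2_sign1 p2_signM p2_signV p2_originM.

Definition p2_elt (x : p2_gen) : p2 := pres_class p2_relators [:: (x, false)].

Lemma p2_act_elt x z : p2_act (p2_elt x) z = p2_move (x, false) z.
Proof. exact: (pres_act_class p2_move_cancel p2_move_relators). Qed.

Lemma p2_elt_comm :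
  (p2_elt gen_a * p2_elt gen_b = p2_elt gen_b * p2_elt gen_a)%g.
Proof.
apply: divg1_eq; rewrite invgM.
have : pres_class p2_relators (([:: (gen_a, false)] ++ [:: (gen_b, false)])
    ++ word_inv [:: (gen_a, false)] ++ word_inv [:: (gen_b, false)]) = 1%g.
  by apply: (proj2 (pres_classP _ _ [::])); apply: pres_rel; left.
by rewrite 3!pres_class_cat 2!pres_class_inv.
Qed.

(** Evaluated at the origin, [1 = g^-1 * g] reads
[0 = p2_sign g^-1 * p2_origin g + p2_origin g^-1]. *)
Lemma p2_originV g : p2_origin g^-1%g = - (p2_sign g)^* * p2_origin g.
Proof.
have := p2_originM g^-1%g g; rewrite mulVg {1}/p2_origin p2_act1 p2_signV.
by move/eqP; rewrite eq_sym addrC addr_eq0 mulNr => /eqP.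
Qed.

Local Notation "c %:[ g ]" := (monalg.mkmalgU g c : group_star_alg R p2)
  (at level 2, format "c %:[ g ]").

Lemma p2_cocycle_surj (z : line R) : exists x, p2_cocycle x = z.
Proof.
exists z%:[p2_elt gen_a]; rewrite group_cocycleU /p2_origin p2_act_elt /=.
by rewrite expr0 add0r mulr1.
Qed.

Lemma p2_cocycle_non_gaussian : non_gaussian p2_cocycle.
Proof.
apply: (line_non_gaussian p2_cocycle_surj (a := 1%:[p2_elt gen_r]) (c := -1)).
  move=> v; rewrite character_repU /p2_sign !p2_act_elt /= mul1r.
  by rewrite oppr0 subr0.
by rewrite [asa_eps _]ga_epsU -subr_eq0 -opprD oppr_eq0 -(natrD _ 1 1) pnatr_eq0.
Qed.

(** Up to sign, the defect of symmetry is twice the imaginary part of [1^* * 'i],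
that is, twice the signed area of the unit cell spanned by the translations [1]
and ['i]; any two commuting translations in independent directions would do. *)
Lemma p2_cocycle_no_functional : ~ admits_generating_functional p2_cocycle.
Proof.
have oa : p2_origin (p2_elt gen_a) = 1.
  by rewrite /p2_origin p2_act_elt /= expr0 add0r.
have ob : p2_origin (p2_elt gen_b) = 'i.
  by rewrite /p2_origin p2_act_elt /= expr0 add0r mul1r.
have sa : p2_sign (p2_elt gen_a) = 1.
  by rewrite /p2_sign !p2_act_elt /=; ring.
have sb : p2_sign (p2_elt gen_b) = 1.
  by rewrite /p2_sign !p2_act_elt /=; ring.
move=> /(@generating_functional_comm _ _ _ _ _ 1%:[p2_elt gen_a]).
move=> /(_ 1%:[p2_elt gen_b]) psi_ab.
have: p2_origin (p2_elt gen_b) * (p2_origin (p2_elt gen_a)^-1%g)^* =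
      p2_origin (p2_elt gen_a) * (p2_origin (p2_elt gen_b)^-1%g)^*.
  rewrite -2!(group_cocycle_ip p2_sign1 p2_signM p2_signV p2_originM).
  by apply: psi_ab; rewrite ![1%:[_] * _]ga_basisM p2_elt_comm.
rewrite !p2_originV oa ob sa sb !rmorph1 !mulN1r !rmorphN rmorph1 mul1r.
rewrite mulrN1 /= conjCi opprK => /eqP.
by rewrite eq_sym -addr_eq0 -mulr2n mulrn_eq0 (negbTE (neq0Ci _)).
Qed.

End P2.

Theorem proposition4p6 (R : realType) :
  let CG := group_star_alg R p2 in
  (exists (D : preHilbert R) (pi : starRep CG D) (eta : cocycle pi),
     non_gaussian eta /\ ~ admits_generating_functional eta)
  /\ ~ property_NC CG /\ ~ property_AC CG.
Proof.
move=> CG; have nG := @p2_cocycle_non_gaussian R.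
have no_psi := @p2_cocycle_no_functional R.
split; first by exists (line R), (p2_rep R), (p2_cocycle R).
by split=> [ncP|acP]; apply: no_psi; [apply: ncP | apply: acP].
Qed.
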